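(* Let $(X, K)$ be a nonempty symmetric space with similarities. (i) There exists a probability measure $\mu$ on $X$ that maximises $D_q^K(\mu)$ for all $q \in [0, \infty]$ simultaneously; that is, there is $\mu \in P(X)$ such that $D_q^K(\mu) \geq D_q^K(\nu)$ for all $\nu \in P(X)$ and all $q \in [0,\infty]$. (ii) The maximum diversity $\sup_{\mu \in P(X)} D_q^K(\mu)$ is independent of $q \in [0, \infty]$.
   Context: A measure means a positive Radon measure. A (compact Hausdorff) space with similarities $(X,K)$ is a compact Hausdorff space $X$ together with a continuous function $K : X \times X \to [0,\infty)$ (a similarity kernel) satisfying $K(x,x) > 0$ for all $x \in X$. It is symmetric if $K(x,y) = K(y,x)$ for all $x,y \in X$. $P(X)$ denotes the set of (Radon) probability measures on $X$. For $\mu \in P(X)$, the typicality function $K\mu : X \to \mathbb{R}$ is $(K\mu)(x) = \int_X K(x,y)\, d\mu(y)$; it is continuous and strictly positive on the support $\operatorname{supp}\mu$ (the smallest closed set whose complement is $\mu$-null). For $q \in [-\infty,\infty]$, the diversity of order $q$ of $\mu \in P(X)$ is $D_q^K(\mu) \in (0,\infty)$ defined by $D_q^K(\mu) = \left( \int_X (K\mu)^{q-1}\, d\mu \right)^{1/(1-q)}$ for $q \in \mathbb{R}\setminus\{1\}$; $D_1^K(\mu) = \exp\left(-\int_X \log(K\mu)\, d\mu\right)$; $D_\infty^K(\mu) = 1/\operatorname{ess\,sup}_\mu K\mu$; $D_{-\infty}^K(\mu) = 1/\operatorname{ess\,inf}_\mu K\mu$ (the integrands being defined on $\operatorname{supp}\mu$,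 hence $\mu$-almost everywhere). *)

(* Defs.v *)
From HB Require Import structures.
From mathcomp Require Import all_boot all_order all_algebra.
From mathcomp Require Import all_classical all_reals all_analysis.
From mathcomp Require Import ess_sup_inf.

Set Implicit Arguments.
Unset Strict Implicit.
Unset Printing Implicit Defensive.

Import Order.TTheory GRing.Theory Num.Theory.
Import numFieldNormedType.Exports.

Local Open Scope classical_set_scope.
Local Open Scope ring_scope.

(* [measurableType]s are pointed, so spaces are taken in [ptopologicalType],
   i.e. nonempty topological spaces. *)
Notation borel X := (g_sigma_algebraType (@open X)).

Section measures.
Context {R : realType} {X : ptopologicalType}.

(* Meant for Hausdorff [X], where compact sets are closed, hence Borel. *)
Definition radon (mu : {measure set (borel X) -> \bar R}) : Prop :=
  (forall C : set X, compact C -> (mu C < +oo)%E) /\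
  (forall A : set (borel X), measurable A ->
     mu A = ereal_sup [set mu C | C in [set C : set X | compact C /\ C `<=` A]]).

Definition radon_probability : set (probability (borel X) R) :=
  [set mu | radon mu].

Definition supp (mu : {measure set (borel X) -> \bar R}) : set X :=
  \bigcap_(C in [set C : set X | closed C /\ mu (~` C) = 0%E]) C.

End measures.

Arguments radon_probability R X : clear implicits.

Section diversity.
Context {R : realType} {X : ptopologicalType}.

Definition similarity_kernel (K : X -> X -> R) : Prop :=
  [/\ continuous (fun xy : X * X => K xy.1 xy.2),
      forall x y, 0 <= K x y &
      forall x, 0 < K x x].

Definition symmetric_kernel (K : X -> X -> R) : Prop :=
  forall x y, K x y = K y x.

Definition typicality (K : X -> X -> R) (mu : probability (borel X) R)
    (x : X) : R :=
  \int[mu]_y K x y.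

(* Integrating over [supp mu], where the typicality is positive, keeps the
   junk values of [powR] and [ln] at 0 out of the integrals.  For a Radon
   probability measure and a similarity kernel on a compact Hausdorff space,
   every integral and essential bound below is finite, so [fine] and
   [Rintegral] lose nothing. *)
Definition diversity (K : X -> X -> R) (q : \bar R)
    (mu : probability (borel X) R) : R :=
  match q with
  | r%:E =>
      if r == 1 then expR (- \int[mu]_(x in supp mu) ln (typicality K mu x))
      else (\int[mu]_(x in supp mu) (typicality K mu x `^ (r - 1)))
             `^ (1 - r)^-1
  | +oo%E => (fine (ess_sup mu (EFin \o typicality K mu)))^-1
  | -oo%E => (fine (ess_inf mu (EFin \o typicality K mu)))^-1
  end.

End diversity.

(* Main.v *)
(** Let [E mu] be the double integral of [K] against [mu].  It is weakly
    continuous, so it has a minimiser [mu] among Radon probability measures;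
    perturbing [mu] along densities [1 - t (K mu - E mu)] shows that [K mu] is
    equal to [E mu] on the support of [mu], so that all the diversities of [mu]
    equal [1 / E mu].  Conversely, let [nu] be any Radon probability measure.
    By Jensen's inequality its diversity of order [q >= 0] is at most
    [D = \int 1 / K nu dnu], and the probability measure [(1 / K nu) nu / D] has
    energy at most [1 / D], by AM-GM and the symmetry of [K].  Hence
    [D <= 1 / E mu].

    Weak limits are obtained along an ultrafilter: the limits of the values on
    closed sets form a content, which extends to a Radon measure. *)

Require Import Defs.
From HB Require Import structures.
From mathcomp Require Import all_boot all_order all_algebra.
From mathcomp Require Import all_classical all_reals all_analysis.
From mathcomp Require Import measurable_realfun ess_sup_inf.
From mathcomp Require Import finmap ring lra.

Set Implicit Arguments.
Unset Strict Implicit.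
Unset Printing Implicit Defensive.

Import Order.TTheory GRing.Theory Num.Theory.
Import numFieldNormedType.Exports.

Local Open Scope classical_set_scope.
Local Open Scope ring_scope.

(** * Bounded measurable functions on a probability space *)

Section bounded_measurable.
Context d (T : measurableType d) (R : realType).
Implicit Types f g : T -> R.

(** [K] is not assumed positive definite, so the energy need not be convex and a first-order
    condition alone does not certify a minimum. That condition only gives the diversities of [mu];
    maximality comes from global minimality, tested on a measure built from the competitor [nu]. The
    tilt by [w = 1 / K nu] is natural because [D] is the diversity of order 0 and also the mass of
    [w nu]: AM-GM bounds the energy of [w nu] by the integral of [K nu * w^2], which is again [D],
    and normalising divides by [D^2]. All measures tested have a bounded density against a Radon
    measure, so they stay Radon, and the perturbed energy is a polynomial in the perturbation
    parameter. [X] need not be metrisable, so a minimising sequence may have no weakly convergent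
    subsequence; bounded real sequences still converge along any ultrafilter. The limiting values on
    closed sets can lose mass compared with the weak limit, hence the passage through a content.
    Bounded measurable functions are the common class of integrands: stable under the algebra used,
    and integrable for every probability measure, so that the real-valued integral is linear on
    them. *)

Definition bounded_measurable f :=
  measurable_fun setT f /\ exists M, forall x, `|f x| <= M.

Lemma bounded_measurable_cst c : bounded_measurable (cst c).
Proof. by split; [exact: measurable_cst | exists `|c|]. Qed.

Lemma bounded_measurableD f g : bounded_measurable f -> bounded_measurable g ->
  bounded_measurable (fun x => f x + g x).
Proof.
move=> [mf [M fM]] [mg [N gN]]; split; first exact: measurable_funD.
by exists (M + N) => x; rewrite (le_trans (ler_normD _ _))// lerD.
Qed.

Lemma bounded_measurableM f g : bounded_measurable f -> bounded_measurable g ->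
  bounded_measurable (fun x => f x * g x).
Proof.
move=> [mf [M fM]] [mg [N gN]]; split; first exact: measurable_funM.
by exists (M * N) => x; rewrite normrM ler_pM.
Qed.

Lemma bounded_measurableZ c f : bounded_measurable f ->
  bounded_measurable (fun x => c * f x).
Proof. exact/bounded_measurableM/bounded_measurable_cst. Qed.

Lemma bounded_measurableB f g : bounded_measurable f -> bounded_measurable g ->
  bounded_measurable (fun x => f x - g x).
Proof.
move=> bf bg; have := bounded_measurableD bf (bounded_measurableZ (-1) bg).
by under eq_fun do rewrite mulN1r.
Qed.

Variable P : probability T R.

Lemma integrable_bounded_measurable D f : measurable D ->
  bounded_measurable f -> P.-integrable D (EFin \o f).
Proof.
move=> mD [mf [M fM]]; apply: measurable_bounded_integrable => //.
- by rewrite (le_lt_trans (probability_le1 _ _))// ltry.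
- exact: measurable_funTS.
- exists M; split; first exact: num_real.
  by move=> y My x _; apply: le_trans (fM x) _; exact: ltW.
Qed.

Lemma expectD f g : bounded_measurable f -> bounded_measurable g ->
  \int[P]_x (f x + g x) = \int[P]_x f x + \int[P]_x g x.
Proof. by move=> bf bg; rewrite RintegralD//; exact: integrable_bounded_measurable. Qed.

Lemma expectB f g : bounded_measurable f -> bounded_measurable g ->
  \int[P]_x (f x - g x) = \int[P]_x f x - \int[P]_x g x.
Proof. by move=> bf bg; rewrite RintegralB//; exact: integrable_bounded_measurable. Qed.

Lemma expectZ c f : bounded_measurable f ->
  \int[P]_x (c * f x) = c * \int[P]_x f x.
Proof. by move=> bf; rewrite RintegralZl//; exact: integrable_bounded_measurable. Qed.

Lemma expect_cst (c : R) : \int[P]_x c = c.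
Proof. by rewrite Rintegral_cst//; have /= -> := probability_setT P; rewrite mulr1. Qed.

Lemma le_expect f g : bounded_measurable f -> bounded_measurable g ->
  (forall x, f x <= g x) -> \int[P]_x f x <= \int[P]_x g x.
Proof.
by move=> bf bg fg; apply: le_Rintegral => //; exact: integrable_bounded_measurable.
Qed.

Lemma expect_bounded f M : bounded_measurable f ->
  (forall x, `|f x| <= M) -> `|\int[P]_x f x| <= M.
Proof.
move=> bf fM; rewrite ler_norml; apply/andP; split.
- rewrite -(expect_cst (- M)); apply: le_expect => //.
    exact: bounded_measurable_cst.
  by move=> x; have := fM x; rewrite ler_norml => /andP[].
- rewrite -[leRHS](expect_cst M); apply: le_expect => //.
    exact: bounded_measurable_cst.
  by move=> x; have := fM x; rewrite ler_norml => /andP[].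
Qed.

Lemma EFin_expect f : bounded_measurable f ->
  (\int[P]_x f x)%:E = (\int[P]_x (f x)%:E)%E.
Proof.
move=> bf; rewrite /Rintegral fineK//; apply: integrable_fin_num => //.
exact: integrable_bounded_measurable.
Qed.

Lemma expect_eq0 f : bounded_measurable f -> (forall x, 0 <= f x) ->
  \int[P]_x f x = 0 -> {ae P, forall x, f x = 0}.
Proof.
move=> bf f0 If0.
have : (\int[P]_x `|(f x)%:E| = 0)%E.
  under eq_integral do rewrite gee0_abs ?lee_fin//.
  by rewrite -EFin_expect// If0.
have mf : measurable_fun setT (EFin \o f) by apply/measurable_EFinP; exact: bf.1.
by move/(ae_eq_integral_abs P measurableT mf); apply: filterS => x /= /(_ I)[].
Qed.

End bounded_measurable.

(** * Iterated integrals of bounded kernels *)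

Section expect_prod.
Context d (T : measurableType d) (R : realType) (P : probability T R).
Implicit Types G : T -> T -> R.

(** Measurability refers to the product sigma-algebra, as Fubini's theorem demands. *)
Let bounded_measurable2 G := bounded_measurable (fun z => G z.1 z.2).

Lemma bounded_measurable_fst (f : T -> R) :
  bounded_measurable f -> bounded_measurable2 (fun x _ => f x).
Proof.
move=> [mf [M fM]]; split; last by exists M => z.
exact: (measurableT_comp mf measurable_fst).
Qed.

Lemma bounded_measurable_snd (f : T -> R) :
  bounded_measurable f -> bounded_measurable2 (fun _ y => f y).
Proof.
move=> [mf [M fM]]; split; last by exists M => z.
exact: (measurableT_comp mf measurable_snd).
Qed.

Lemma bounded_measurable_section G x :
  bounded_measurable2 G -> bounded_measurable (G x).
Proof.
move=> [mG [M GM]]; split; last by exists M => y; exact: (GM (x, y)).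
exact: (measurable_fun_pair2 x mG).
Qed.

Lemma bounded_measurable_section2 G y :
  bounded_measurable2 G -> bounded_measurable (G^~ y).
Proof.
move=> [mG [M GM]]; split; last by exists M => x; exact: (GM (x, y)).
exact: (measurable_fun_pair1 y mG).
Qed.

Let integrable2 G : bounded_measurable2 G ->
  ((P \x P)%E).-integrable setT (fun z => (G z.1 z.2)%:E).
Proof. by move=> bG; apply: integrable_bounded_measurable. Qed.

Lemma bounded_measurable_expect G : bounded_measurable2 G ->
  bounded_measurable (fun x => \int[P]_y G x y).
Proof.
move=> bG; split; last first.
  have [_ [M GM]] := bG; exists M => x; apply: expect_bounded.
    exact: bounded_measurable_section.
  by move=> y; exact: (GM (x, y)).
apply/measurable_EFinP.
under [X in measurable_fun _ X]eq_fun.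
  move=> x /=; rewrite EFin_expect; last exact: bounded_measurable_section.
  over.
exact: (measurable_fubini_F (integrable2 bG)).
Qed.

Lemma expect_Fubini G : bounded_measurable2 G ->
  \int[P]_x \int[P]_y G x y = \int[P]_y \int[P]_x G x y.
Proof.
move=> bG; rewrite {1}/Rintegral; under eq_integral.
  move=> x _; rewrite EFin_expect; last exact: bounded_measurable_section.
  over.
rewrite (Fubini (integrable2 bG)) [RHS]/Rintegral; congr fine.
apply: eq_integral => y _; rewrite EFin_expect//.
exact: bounded_measurable_section2.
Qed.

End expect_prod.

(** * Densities and the energy form *)

Section density.
Context d (T : measurableType d) (R : realType) (P : probability T R).
Variable f : T -> R.
Hypotheses (bf : bounded_measurable f) (f0 : forall x, 0 <= f x).
Hypothesis If1 : \int[P]_x f x = 1.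

Let Q (A : set T) : \bar R := (\int[P]_(x in A) (f x)%:E)%E.

Let mf : measurable_fun setT (EFin \o f).
Proof. by apply/measurable_EFinP; exact: bf.1. Qed.

Let Q0 : Q set0 = 0%E. Proof. exact: integral_set0. Qed.

Let Q_ge0 A : (0 <= Q A)%E.
Proof. by apply: integral_ge0 => x _; rewrite lee_fin. Qed.

Let Q_sigma_additive : semi_sigma_additive Q.
Proof.
move=> F mF tF mUF; rewrite [X in _ --> X](_ : _ = (\sum_(i <oo) Q (F i))%E).
  by apply: is_cvg_nneseries => n _ _; exact: Q_ge0.
apply: ge0_integral_bigcup => //; first exact: measurable_funTS.
by move=> x _; rewrite lee_fin.
Qed.

HB.instance Definition _ := isMeasure.Build _ _ _ Q Q0 Q_ge0 Q_sigma_additive.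

Let QT : Q setT = 1%E.
Proof. by rewrite /Q -EFin_expect// If1. Qed.

HB.instance Definition _ := Measure_isProbability.Build _ _ _ Q QT.

(** The second clause goes through the Radon-Nikodym derivative of [Q], which equals [f] almost
    everywhere because both have the same integral over every measurable set. *)
Lemma exists_density : exists Q : probability T R,
  (forall A, measurable A -> Q A = \int[P]_(x in A) (f x)%:E)%E /\
  forall h, bounded_measurable h -> \int[Q]_x h x = \int[P]_x (h x * f x).
Proof.
exists Q; split => // h bh.
have QP : Q `<< P.
  apply/null_content_dominatesP => A mA PA0.
  by apply: null_set_integral => //; exact: measurable_funTS.
have QE : ae_eq P setT (Radon_Nikodym (charge_of_finite_measure Q) P) (EFin \o f).
  apply: integral_ae_eq => //; first exact: Radon_Nikodym_integrable.
  by move=> A _ mA; rewrite -Radon_Nikodym_integral.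
rewrite /Rintegral -(Radon_Nikodym_change_of_variables QP)//; last first.
  exact: integrable_bounded_measurable.
congr fine; apply: ae_eq_integral => //.
- apply: emeasurable_funM; first by apply/measurable_EFinP; exact: bh.1.
  by apply: measurable_int; exact: Radon_Nikodym_integrable.
- by apply/measurable_EFinP; exact: (bounded_measurableM bh bf).1.
- by apply: filterS QE => x /(_ I) /= -> _; rewrite EFinM.
Qed.

End density.

(** * The energy as a bilinear form in densities *)

Section energy_form.
Context d (T : measurableType d) (R : realType) (P : probability T R).
Variable K : T -> T -> R.
Hypothesis bK : bounded_measurable (fun z => K z.1 z.2).
Implicit Types f g : T -> R.

(** The typicality function of the measure with density [f] against [P], for signed [f] as well;
    [energy_form] is the associated mutual energy. With [P] fixed, perturbing a measure becomes
    linear algebra on densities. *)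
Definition potential f x := \int[P]_y (K x y * f y).

Definition energy_form f g := \int[P]_x (potential g x * f x).

Let bKf f : bounded_measurable f ->
  bounded_measurable (fun z : T * T => K z.1 z.2 * f z.2).
Proof. by move=> bf; apply: bounded_measurableM => //; exact: bounded_measurable_snd. Qed.

Let bKx f x : bounded_measurable f -> bounded_measurable (fun y => K x y * f y).
Proof. by move=> /bKf; exact: (@bounded_measurable_section _ _ _ (fun x y => K x y * f y)). Qed.

Lemma bounded_measurable_potential f : bounded_measurable f ->
  bounded_measurable (potential f).
Proof. by move=> /bKf; exact: (@bounded_measurable_expect _ _ _ P (fun x y => K x y * f y)). Qed.

Lemma potentialD f g x : bounded_measurable f -> bounded_measurable g ->
  potential (fun y => f y + g y) x = potential f x + potential g x.
Proof.
by move=> bf bg; rewrite /potential -expectD; [|exact: bKx..];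
  apply: eq_Rintegral => y _; rewrite mulrDr.
Qed.

Lemma potentialZ c f x : bounded_measurable f ->
  potential (fun y => c * f y) x = c * potential f x.
Proof.
move=> bf; rewrite /potential -expectZ; last exact: bKx.
by apply: eq_Rintegral => y _; rewrite mulrCA.
Qed.

Lemma energy_formDr f g h :
  bounded_measurable f -> bounded_measurable g -> bounded_measurable h ->
  energy_form f (fun y => g y + h y) = energy_form f g + energy_form f h.
Proof.
move=> bf bg bh; rewrite /energy_form -expectD;
  [|exact/bounded_measurableM/bf/bounded_measurable_potential..].
by apply: eq_Rintegral => x _; rewrite potentialD// mulrDl.
Qed.

Lemma energy_formZr c f g : bounded_measurable f -> bounded_measurable g ->
  energy_form f (fun y => c * g y) = c * energy_form f g.
Proof.
move=> bf bg; rewrite /energy_form -expectZ;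
  last exact/bounded_measurableM/bf/bounded_measurable_potential.
by apply: eq_Rintegral => x _; rewrite potentialZ// mulrA.
Qed.

Hypothesis symK : forall x y, K x y = K y x.

Lemma energy_formC f g : bounded_measurable f -> bounded_measurable g ->
  energy_form f g = energy_form g f.
Proof.
move=> bf bg; rewrite /energy_form.
transitivity (\int[P]_x \int[P]_y (f x * (K x y * g y))).
  apply: eq_Rintegral => x _; rewrite mulrC -expectZ//; exact: bKx.
rewrite expect_Fubini; last first.
  by apply: bounded_measurableM; [exact: bounded_measurable_fst|exact: bKf].
apply: eq_Rintegral => y _; rewrite mulrC -expectZ; last exact: bKx.
by apply: eq_Rintegral => x _; rewrite symK; ring.
Qed.

Hypothesis K0 : forall x y, 0 <= K x y.

(* AM-GM under the double integral: [w x * w y <= (w x ^ 2 + w y ^ 2) / 2]. *)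
Lemma energy_form_le_sqr w : bounded_measurable w ->
  energy_form w w <= \int[P]_x (potential (cst 1) x * (w x * w x)).
Proof.
move=> bw; have bw2 := bounded_measurableM bw bw.
have b1 := bounded_measurable_cst T (1 : R).
have bp1 := bounded_measurable_potential b1.
have bpw2 := bounded_measurable_potential bw2.
have bpw := bounded_measurable_potential bw.
rewrite -/(energy_form (fun x => w x * w x) (cst 1)).
(* By symmetry of [K] the two halves of the AM-GM bound have the same double integral. *)
suff : energy_form w w <= \int[P]_x
    (2^-1 * (potential (cst 1) x * (w x * w x)) +
     2^-1 * (potential (fun y => w y * w y) x * cst 1 x)).
  rewrite expectD; [|apply: bounded_measurableZ; exact: bounded_measurableM..].
  rewrite !expectZ; [|exact: bounded_measurableM..].
  rewrite -/(energy_form (fun x => w x * w x) (cst 1)).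
  rewrite -/(energy_form (cst 1) (fun x => w x * w x)).
  by rewrite (energy_formC b1 bw2); lra.
apply: le_expect.
- exact: bounded_measurableM.
- by apply: bounded_measurableD; apply: bounded_measurableZ;
    exact: bounded_measurableM.
move=> x; rewrite /= mulr1.
have -> : potential w x * w x = \int[P]_y (w x * (K x y * w y)).
  by rewrite mulrC expectZ//; exact: bKx.
have -> : 2^-1 * (potential (cst 1) x * (w x * w x)) +
    2^-1 * potential (fun y => w y * w y) x =
  \int[P]_y ((2^-1 * (w x * w x)) * (K x y * cst 1 y) +
             2^-1 * (K x y * (w y * w y))).
  rewrite expectD; [|apply: bounded_measurableZ; exact: bKx..].
  rewrite !expectZ; [|exact: bKx..].
  by rewrite -!/(potential _ _); ring.
apply: le_expect.
- by apply: bounded_measurableZ; exact: bKx.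
- by apply: bounded_measurableD; apply: bounded_measurableZ; exact: bKx.
move=> y /=; have := K0 x y; have := sqr_ge0 (w x - w y); nra.
Qed.

(* First-order condition along the densities [1 - t (potential - c)]. *)
Lemma energy_minimizer_balanced :
  (forall f, bounded_measurable f -> (forall x, 0 <= f x) ->
     \int[P]_x f x = 1 -> energy_form (cst 1) (cst 1) <= energy_form f f) ->
  {ae P, forall x, potential (cst 1) x = energy_form (cst 1) (cst 1)}.
Proof.
set c := energy_form _ _; set k := potential _ => cmin.
have b1 := bounded_measurable_cst T (1 : R).
have bk : bounded_measurable k := bounded_measurable_potential b1.
(* [c] is the mean of [k], so [h] has mean 0 and [1 - t h] has integral 1; moreover the mutual
   energy of [h] and 1 is the variance [V] of [k]. *)
pose h x := k x - c.
have bh : bounded_measurable h.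
  exact/bounded_measurableB/bounded_measurable_cst.
have bhh := bounded_measurableM bh bh.
have Ih0 : \int[P]_x h x = 0.
  rewrite expectB//; last exact: bounded_measurable_cst.
  rewrite expect_cst; apply/eqP; rewrite subr_eq0; apply/eqP.
  by apply: eq_Rintegral => x _; rewrite mulr1.
pose V := \int[P]_x (h x * h x).
have V0 : 0 <= V by apply: Rintegral_ge0 => x _; rewrite -expr2 sqr_ge0.
have h1 : energy_form h (cst 1) = V.
  rewrite /energy_form -/k (_ : V = V + c * \int[P]_x h x); last first.
    by rewrite Ih0 mulr0 addr0.
  rewrite -expectZ// -expectD//; last exact: bounded_measurableZ.
  by apply: eq_Rintegral => x _; rewrite /h; ring.
have [H hH] := bh.2.
have H0 : 0 <= H by exact: le_trans (normr_ge0 _) (hH point).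
(* The energy of [1 - t h] is [c - 2 t V + t^2 energy_form h h]; minimality of [c] and division by
   [t] give the bound. The condition on [t] keeps the density nonnegative. *)
have quad t : 0 < t -> t * (H + 1) <= 1 -> 2 * V <= t * energy_form h h.
  move=> t0 tH; pose f x := 1 + (- t) * h x.
  have bth := bounded_measurableZ (- t) bh.
  have bf : bounded_measurable f by exact: bounded_measurableD.
  have /cmin : bounded_measurable f by [].
  have f0 x : 0 <= f x.
    by rewrite /f; have := hH x; rewrite ler_norml => /andP[? ?]; nra.
  have If : \int[P]_x f x = 1.
    by rewrite expectD// expect_cst expectZ// Ih0 mulr0 addr0.
  have fE g : bounded_measurable g ->
      energy_form g f = energy_form g (cst 1) + (- t) * energy_form g h.
    by move=> bg; rewrite -energy_formZr// -energy_formDr.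
  move=> /(_ f0 If); rewrite (fE _ bf) (energy_formC bf b1) (energy_formC bf bh).
  rewrite (fE _ b1) (fE _ bh) (energy_formC b1 bh) h1 -/c => cc.
  by rewrite -(ler_pM2l t0); lra.
have V_eq0 : V = 0.
  apply/eqP; rewrite eq_le V0 andbT leNgt; apply/negP => Vp.
  pose S := energy_form h h.
  have S0 : 0 < S.
    have H1 : 0 < (H + 1)^-1 by rewrite invr_gt0; lra.
    have := quad _ H1; rewrite mulVf; last by apply/eqP; lra.
    by move=> /(_ (lexx _)); rewrite -/S => VS; rewrite -(pmulr_rgt0 _ H1); lra.
  (* At [t = D^-1] the bound reads [2 V <= S / D], whereas [D > S / V] forces [S / D < V]. *)
  pose D := (H + 1) + S / V.
  have SV : 0 < S / V by rewrite divr_gt0.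
  have D0 : 0 < D by rewrite /D; lra.
  have D1 : 0 < D^-1 by rewrite invr_gt0.
  have := quad _ D1.
  have HD : H + 1 <= D by rewrite /D; lra.
  rewrite [_ * (H + 1)]mulrC ler_pdivrMr// mul1r => /(_ HD).
  rewrite -/S [_ * S]mulrC ler_pdivlMr// /D mulrDr.
  rewrite -[2 * V * (S / V)]mulrA [V * _]mulrC divfK ?gt_eqF//.
  by have := mulr_ge0 V0 H0; lra.
have hh0 x : 0 <= h x * h x by rewrite -expr2 sqr_ge0.
have := expect_eq0 bhh hh0 V_eq0.
apply: filterS => x /eqP; rewrite mulf_eq0 orbb subr_eq0 => /eqP.
exact.
Qed.

End energy_form.

(** * Continuous functions and kernels on a compact space *)

HB.instance Definition _ (X Y : ptopologicalType) := Pointed.on (X * Y)%type.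

Section continuous_on_compact.
Context {R : realType} {X : ptopologicalType}.
Hypothesis cptX : compact [set: X].

Lemma open_borel (U : set (borel X)) : @open X U -> measurable U.
Proof. exact: sub_sigma_algebra. Qed.

Lemma closed_borel (C : set (borel X)) : @closed X C -> measurable C.
Proof. by move=> /closed_openC/open_borel/measurableC; rewrite setCK. Qed.

Lemma measurable_continuous (f : X -> R) : continuous f ->
  measurable_fun setT (f : borel X -> R).
Proof.
move=> /continuousP cf; apply: (measurability _ (RGenOpens.measurableE R)).
move=> _ [_ [a [b ->] <-]]; rewrite setTI.
by apply: open_borel; apply: (cf `]a, b[%classic); exact: interval_open.
Qed.

Lemma continuous_bounded_measurable (f : X -> R) : continuous f ->
  bounded_measurable (f : borel X -> R).
Proof.
move=> cf; split; first exact: measurable_continuous.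
have /compact_bounded[M [_ fM]] : compact (f @` setT).
  by apply: continuous_compact => //; exact: continuous_subspaceT.
exists (M + 1) => x; apply: fM; first by rewrite ltrDl.
by exists x.
Qed.

(* Borel sets of [X * X] need not be product measurable; those of the form
   [G > a] are, being countable unions of the compact sets [a + 1/n <= G],
   each covered by finitely many open boxes. *)
Lemma measurable_continuous2 (G : X * X -> R) : continuous G ->
  measurable_fun setT (G : borel X * borel X -> R).
Proof.
move=> cG; apply: (measurability _ (RGenOInfty.measurableE R)).
move=> _ [_ [a ->] <-]; rewrite setTI preimage_itvoy.
pose U := [set z | a < G z].
have oU : open U by move/continuousP: (cG) => /(_ _ (@open_gt R a)).
have /choice[f fP] (z : X * X) : exists W : set X * set X, U z ->
    [/\ open W.1, open W.2, (W.1 `*` W.2) z & W.1 `*` W.2 `<=` U].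
  have [Uz|] := pselect (U z); last by exists (set0, set0).
  have : nbhs z U by exact: open_nbhs_nbhs.
  case=> -[A B] /= [nA nB] AB; exists (A°, B°) => _; split => /=.
  - exact: open_interior.
  - exact: open_interior.
  - by split; [exact: nA|exact: nB].
  - by move=> [x y] /= [/interior_subset Ax /interior_subset By]; exact: AB.
pose box z := (f z).1 `*` (f z).2.
have fin n : exists D : {fset (X * X)%type}, {subset D <= U} /\
    [set z | a + n.+1%:R^-1 <= G z] `<=` cover [set` D] box.
  have cZ : compact [set z | a + n.+1%:R^-1 <= G z].
    apply: (@subclosed_compact _ _ [set: X * X]) => //.
      exact: ((continuous_closedP G).1 cG _ (@closed_ge R _)).
    by rewrite -setXTT; exact: compact_setX.
  have : cover_compact [set z | a + n.+1%:R^-1 <= G z].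
    by rewrite -(@compact_cover (X * X)%type).
  move=> /(_ _ U box)[].
  - move=> z /fP[oA oB _ _]; rewrite openE => -[x y] [/= Ax By].
    exists ((f z).1, (f z).2) => /=; last by [].
    by split; apply: open_nbhs_nbhs.
  - move=> z /= az; have Uz : U z by apply: lt_le_trans az; rewrite ltrDl.
    by exists z => //; have [] := fP _ Uz.
  - by move=> D DU ZD; exists D.
have [D DP] := choice fin.
rewrite (_ : [set _ | _] = \bigcup_n \bigcup_(z in [set` D n]) box z).
  apply: bigcupT_measurable => n; apply: fin_bigcup_measurable => // z Dz.
  have : z \in U := (DP n).1 z Dz => /set_mem/fP[oA oB _ _].
  by apply: measurableX; exact: open_borel.
apply/seteqP; split => [z /= az|z [n _ [w Dw]]]; last first.
  by have : w \in U := (DP n).1 w Dw => /set_mem/fP[_ _ _]; exact.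
have : 0 < G z - a by rewrite subr_gt0.
move=> /ltr_add_invr[n]; rewrite add0r => na.
have zn : [set z | a + n.+1%:R^-1 <= G z] z by rewrite /= -lerBrDl ltW.
have [w Dw wz] := (DP n).2 z zn.
by exists n => //; exists w.
Qed.

Lemma continuous_bounded_measurable2 (K : X -> X -> R) :
  continuous (fun z : X * X => K z.1 z.2) ->
  bounded_measurable (fun z : borel X * borel X => K z.1 z.2).
Proof.
move=> cK; split; first exact: measurable_continuous2.
have /compact_bounded[M [_ KM]] : compact ((fun z => K z.1 z.2) @` setT).
  apply: continuous_compact; first exact: continuous_subspaceT.
  by rewrite -setXTT; exact: compact_setX.
exists (M + 1) => x; apply: KM; first by rewrite ltrDl.
by exists x.
Qed.

(** Joint continuity gives the estimate near each [y]; compactness in the second variable makes one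
    neighbourhood of [x] serve every [y]. *)
Lemma kernel_equicontinuous (K : X -> X -> R) (e : R) (x : X) :
  continuous (fun z : X * X => K z.1 z.2) -> 0 < e ->
  \forall x' \near x, forall y, `|K x y - K x' y| < e.
Proof.
move=> cK e0; have /compact_near_coveringP ncX := cptX.
have e20 : 0 < e / 2 by rewrite divr_gt0.
suff cov : forall y : X, setT y ->
    \forall y' \near y & x' \near x, `|K x y' - K x' y'| < e.
  have h := ncX X (nbhs x) (fun x' y => `|K x y - K x' y| < e) (nbhs_filter x) cov.
  by apply: (filterS _ h) => x' hx' y; exact: hx'.
move=> y _; have /cvgrPdist_lt/(_ _ e20) := cK (x, y).
case=> -[A B] /= [nA nB] AB.
exists (B, A) => //= -[y' x'] /= [By' Ax'].
have h1 := AB (x', y') (conj Ax' By').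
have h2 := AB (x, y') (conj (nbhs_singleton nA) By').
rewrite /= in h1 h2.
rewrite (_ : _ - _ = (K x y - K x' y') - (K x y - K x y')); last by ring.
by rewrite (le_lt_trans (ler_normB _ _))// (splitr e) ltrD.
Qed.

End continuous_on_compact.

(** * From contents to Radon measures *)

(** The Caratheodory sets form a sigma-algebra on which [mu] is countably additive; once it contains
    the open sets it contains the Borel sets. *)
Lemma caratheodory_borel (R : realType) (X : ptopologicalType)
    (mu : {outer_measure set X -> \bar R}) :
  (forall U : set X, open U -> mu.-caratheodory U) ->
  exists m : {measure set (borel X) -> \bar R}, forall A, m A = mu A.
Proof.
move=> openM.
have sub : (@measurable _ (borel X)) `<=` mu.-cara.-measurable.
  apply: smallest_sub; first exact: sigma_algebra_measurable.
  by move=> U oU; exact: openM.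
have mu0 : mu (set0 : set (borel X)) = 0%E by exact: outer_measure0.
have mu_ge0 (A : set (borel X)) : (0 <= mu A)%E by exact: outer_measure_ge0.
have mu_sigma : semi_sigma_additive (mu : set (borel X) -> \bar R).
  move=> F mF tF mUF; apply: caratheodory_measure_sigma_additive => //.
  - by move=> i; exact: sub.
  - exact: sub.
pose m := isMeasure.Build _ (borel X) R (mu : set (borel X) -> \bar R)
  mu0 mu_ge0 mu_sigma.
pose m' : {measure set (borel X) -> \bar R} := HB.pack (mu : set (borel X) -> \bar R) m.
by exists m'.
Qed.

Section content.
Context {R : realType} {X : ptopologicalType}.
Hypotheses (cptX : compact [set: X]) (hausX : hausdorff_space X).

Lemma closed_compactT (C : set X) : closed C -> compact C.
Proof. by move=> cC; exact: (subclosed_compact cC cptX). Qed.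

(** Normality separates the closed set [C \ U] from the part of [C] outside [V]. This is what makes
    the inner content of open sets subadditive. *)
Lemma closed_split (C U V : set X) : closed C -> open U -> open V ->
  C `<=` U `|` V -> exists C1 C2, [/\ closed C1, closed C2, C1 `<=` U,
    C2 `<=` V & C = C1 `|` C2].
Proof.
move=> cC oU oV CUV.
have cA : closed (C `\` U) by apply: closedI => //; exact: open_closedC.
have := compact_normal hausX cptX cA.
have snV : set_nbhs (C `\` U) (~` C `|` V).
  apply/set_nbhsP; exists (~` C `|` V); split => //.
    by apply: openU => //; exact: closed_openC.
  by move=> x [Cx nUx]; right; have [] := CUV _ Cx.
move=> /(_ _ snV)[W /set_nbhsP[G [oG AG GW]] WV].
exists (C `\` G), (C `&` closure W); split.
- by apply: closedI => //; exact: open_closedC.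
- by apply: closedI => //; exact: closed_closure.
- by move=> x [Cx nGx]; apply: contrapT => nUx; apply: nGx; exact: AG.
- by move=> x [Cx /WV[]].
apply/seteqP; split => [x Cx|x []-[]//].
have [Gx|nGx] := pselect (G x); last by left.
by right; split => //; apply: subset_closure; exact: GW.
Qed.

Variable v : set X -> R.
Hypothesis v0 : v set0 = 0.
Hypothesis v_mono : forall C D, closed C -> closed D -> C `<=` D -> v C <= v D.
Hypothesis v_subU : forall C D, closed C -> closed D -> v (C `|` D) <= v C + v D.
Hypothesis v_addU : forall C D, closed C -> closed D -> C `&` D = set0 ->
  v (C `|` D) = v C + v D.

Local Open Scope ereal_scope.

(** The classical two-stage regularisation of a content: from closed sets to open sets by inner
    approximation, then to all sets by outer approximation. *)
Definition inner_content (U : set X) : \bar R :=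
  ereal_sup [set (v C)%:E | C in [set C | closed C /\ C `<=` U]].

Definition outer_content (A : set X) : \bar R :=
  ereal_inf [set inner_content U | U in [set U | open U /\ A `<=` U]].

Lemma inner_content_ub C U : closed C -> C `<=` U -> (v C)%:E <= inner_content U.
Proof. by move=> cC CU; apply: ereal_sup_ubound; exists C. Qed.

Lemma inner_content_ge0 U : 0 <= inner_content U.
Proof.
have <- : (v set0)%:E = 0 by rewrite v0.
by apply: inner_content_ub => //; exact: closed0.
Qed.

Lemma inner_content_le U : inner_content U <= (v setT)%:E.
Proof.
apply: ge_ereal_sup => _ [C [cC _] <-].
by rewrite lee_fin; apply: v_mono => //; exact: closedT.
Qed.

Lemma le_inner_content U V : U `<=` V -> inner_content U <= inner_content V.
Proof.
move=> UV; apply: ge_ereal_sup => _ [C [cC CU] <-].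
by apply: inner_content_ub => //; exact: subset_trans UV.
Qed.

Lemma outer_content_le A U : open U -> A `<=` U ->
  outer_content A <= inner_content U.
Proof. by move=> oU AU; apply: ereal_inf_lbound; exists U. Qed.

Lemma outer_content_open U : open U -> outer_content U = inner_content U.
Proof.
move=> oU; apply/eqP; rewrite eq_le outer_content_le//=.
by apply: le_ereal_inf_tmp => _ [V [oV UV] <-]; exact: le_inner_content.
Qed.

(** Equality may fail: for the limit of unit masses at points other than [x] that converge to [x],
    the set [{x}] has content 0 but outer content 1. *)
Lemma outer_content_closed C : closed C -> (v C)%:E <= outer_content C.
Proof.
by move=> cC; apply: le_ereal_inf_tmp => _ [U [_ CU] <-]; exact: inner_content_ub.
Qed.

Lemma outer_content_ge0 A : 0 <= outer_content A.
Proof. by apply: le_ereal_inf_tmp => _ [U _ <-]; exact: inner_content_ge0. Qed.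

Lemma outer_content_fin_num A : outer_content A \is a fin_num.
Proof.
rewrite ge0_fin_numE ?outer_content_ge0//.
apply: le_lt_trans (ltry (v setT)); apply: le_trans (inner_content_le setT).
by apply: outer_content_le => //; exact: openT.
Qed.

Lemma outer_content0 : outer_content set0 = 0.
Proof.
rewrite outer_content_open; last exact: open0.
apply/eqP; rewrite eq_le inner_content_ge0 andbT.
by apply: ge_ereal_sup => _ [C [_ C0] <-]; rewrite (_ : C = set0) ?v0// -subset0.
Qed.

Lemma le_outer_content : {homo outer_content : A B / A `<=` B >-> A <= B}.
Proof.
move=> A B AB; apply: le_ereal_inf_tmp => _ [U [oU BU] <-].
by apply: outer_content_le => //; exact: subset_trans BU.
Qed.

Lemma content_finite_cover (U : (set X)^nat) n C : (forall i, open (U i)) ->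
  closed C -> C `<=` \bigcup_(i < n) U i ->
  (v C)%:E <= \sum_(0 <= i < n) inner_content (U i).
Proof.
move=> oU; elim: n C => [|n IH] C cC.
  by rewrite bigcup_mkord big_ord0 subset0 => ->; rewrite v0 big_geq.
rewrite bigcup_mkord big_ord_recr /= -bigcup_mkord => CU.
have oB : open (\bigcup_(i < n) U i) by apply: bigcup_open => i _.
have [C1 [C2 [cC1 cC2 C1U C2U ->]]] := closed_split cC oB (oU n) CU.
rewrite big_nat_recr//=; apply: (@le_trans _ _ ((v C1)%:E + (v C2)%:E)).
  by rewrite -EFinD lee_fin; exact: v_subU.
by apply: leeD; [exact: IH|exact: inner_content_ub].
Qed.

Lemma inner_content_sigma_subadditive (U : (set X)^nat) :
  (forall i, open (U i)) ->
  inner_content (\bigcup_i U i) <= \sum_(i <oo) inner_content (U i).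
Proof.
move=> oU; apply: ge_ereal_sup => _ [C [cC CU] <-].
have /compact_near_coveringP ncC := closed_compactT cC.
(* The near-covering property is applied with the filter [\oo] on indices, so that a single finite
   union covers all of [C]. *)
have cov : forall x : X, C x ->
    \forall x' \near x & n \near \oo, (\bigcup_(i < n) U i) x'.
  move=> x /CU[i _ Ux]; exists (U i, [set n | (i < n)%N]) => /=.
    by split; [exact: open_nbhs_nbhs | exact: nbhs_infty_gt].
  by move=> [x' n] /= [Ux' ni]; exists i.
have [n _ /(_ n (leqnn n)) Cn] := ncC nat \oo _ _ cov.
apply: le_trans (content_finite_cover oU cC Cn) _.
by apply: nneseries_lim_ge => i _ _; exact: inner_content_ge0.
Qed.

Lemma outer_content_sigma_subadditive : sigma_subadditive outer_content.
Proof.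
move=> A; apply/lee_addgt0Pr => e e0.
rewrite (le_trans _ (epsilon_trick _ _ (ltW e0)))//; last first.
  by move=> n; exact: outer_content_ge0.
have /choice[U UP] n : exists U, [/\ open U, A n `<=` U &
    inner_content U <= outer_content (A n) + (e / (2 ^ n.+1)%:R)%:E].
  have en : (0 < e / (2 ^ n.+1)%:R)%R by rewrite divr_gt0// ltr0n expn_gt0.
  have [_ [U [oU AU] <-] /ltW leU] :=
    lb_ereal_inf_adherent en (outer_content_fin_num (A n)).
  by exists U.
apply: (@le_trans _ _ (inner_content (\bigcup_n U n))).
  apply: outer_content_le; first by apply: bigcup_open => n _; have [] := UP n.
  by apply: subset_bigcup => n _; have [] := UP n.
apply: (@le_trans _ _ (\sum_(i <oo) inner_content (U i))).
  by apply: inner_content_sigma_subadditive => n; have [] := UP n.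
apply: lee_nneseries => n *; first exact: inner_content_ge0.
by have [] := UP n.
Qed.

HB.instance Definition _ := isOuterMeasure.Build R X outer_content
  outer_content0 outer_content_ge0 le_outer_content
  outer_content_sigma_subadditive.

(** For an open [G] containing [A], take a closed [C] inside [G] and [U], then a closed [D] inside
    the open set [G \ C], which contains the part of [A] outside [U]. As [C] and [D] are disjoint,
    additivity gives [v C + v D <= inner_content G]; suprema over [D] and then [C] conclude. *)
Lemma caratheodory_outer_content U : open U -> outer_content.-caratheodory U.
Proof.
move=> oU; apply: le_caratheodory_measurable => A.
apply: le_ereal_inf_tmp => _ [G [oG AG] <-].
apply: (@le_trans _ _ (inner_content (G `&` U) + outer_content (A `&` ~` U))).
  rewrite leeD2r//; apply: outer_content_le; first exact: openI.
  exact: setSI.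
rewrite -leeBrDr ?outer_content_fin_num//.
apply: ge_ereal_sup => _ [C [cC CGU] <-].
rewrite leeBrDr ?outer_content_fin_num// -leeBrDl//.
apply: (@le_trans _ _ (inner_content (G `\` C))).
  apply: outer_content_le; first by apply: openI => //; exact: closed_openC.
  by move=> x [/AG Gx nUx]; split => // /CGU[].
apply: ge_ereal_sup => _ [D [cD DGC] <-].
rewrite leeBrDl// -EFinD -v_addU//; last first.
  by apply/seteqP; split => // x [Cx /DGC[]].
apply: inner_content_ub; first exact: closedU.
by move=> x [/CGU[]|/DGC[]].
Qed.

Lemma content_radon_measure : exists m : {measure set (borel X) -> \bar R},
  [/\ radon m, m setT = (v setT)%:E &
   forall C, closed C -> (v C)%:E <= m C].
Proof.
have [m] := caratheodory_borel caratheodory_outer_content.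
rewrite /= => mE.
have mC C : closed C -> (v C)%:E <= m C.
  by move=> cC; rewrite mE; exact: outer_content_closed.
have mT : m setT = (v setT)%:E.
  apply/eqP; rewrite eq_le mC ?andbT; last exact: closedT.
  by rewrite mE outer_content_open ?inner_content_le//; exact: openT.
have mfin A : m A \is a fin_num by rewrite mE; exact: outer_content_fin_num.
exists m; split => //; split => [C _|A mA]; first by rewrite -ge0_fin_numE.
apply/eqP; rewrite eq_le; apply/andP; split; last first.
  apply: ge_ereal_sup => _ [C [cC CA] <-]; apply: le_measure => //.
    by apply: mem_set; apply: closed_borel; exact: compact_closed.
  exact: mem_set.
(* Inner regularity is outer regularity of the complement: if the open [U] contains the complement
   of [A] and exceeds its mass by less than [e], the complement of [U] is compact, lies in [A] and
   misses less than [e] of its mass. *)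
apply/lee_addgt0Pr => e e0.
have [_ [U [oU AU] <-] ltU] :=
  lb_ereal_inf_adherent e0 (outer_content_fin_num (~` A)).
rewrite -/(outer_content _) -outer_content_open// -!mE in ltU.
have mU : measurable (U : set (borel X)) by exact: open_borel.
have cU : closed (~` U) by exact: open_closedC.
apply: (@le_trans _ _ (m (~` U) + e%:E)); last first.
  rewrite leeD2r//; apply: ereal_sup_ubound; exists (~` U) => //; split.
    exact: closed_compactT.
  by rewrite -[A in _ `<=` A]setCK; exact: subsetC.
have splitT (B : set (borel X)) : measurable B -> m B + m (~` B) = m setT.
  move=> mB; rewrite -measureU//; [|exact: measurableC|exact: setICr].
  by rewrite setUCr.
have := splitT _ mA; rewrite -(splitT _ mU).
move: ltU; rewrite -(fineK (mfin A)) -(fineK (mfin (~` A))) -(fineK (mfin U)).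
rewrite -(fineK (mfin (~` U))) -!EFinD lte_fin lee_fin => ltU [].
lra.
Qed.

End content.

(** * Weak limits along an ultrafilter *)

Section probability_of_measure.
Context d (T : measurableType d) (R : realType).
Variable m : {measure set T -> \bar R}.
Hypothesis mT : m setT = 1%E.

Let P (A : set T) := m A.

HB.instance Definition _ := isMeasure.Build _ _ _ P
  (measure0 m) (measure_ge0 m) (@measure_semi_sigma_additive _ _ _ m).

HB.instance Definition _ := Measure_isProbability.Build _ _ _ P mT.

Lemma probability_of_measure : exists Q : probability T R, forall A, Q A = m A.
Proof. by exists P. Qed.

End probability_of_measure.

(** The image filter clusters at a point of the compact segment, and an ultrafilter converges to
    each of its cluster points. *)
Lemma ultra_cvg_bounded (R : realType) (T : Type) (F : set_system T)
    (u : T -> R) (M : R) : UltraFilter F -> (forall n, `|u n| <= M) ->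
  cvg (u n @[n --> F]).
Proof.
move=> FU uM; have PF : ProperFilter (u n @[n --> F]) := fmap_proper_filter u (@ultra_proper _ _ FU).
have [|p [_ clp]] := segment_compact (a := - M) (b := M) PF.
  by apply: (@filterE _ F) => n /=; rewrite in_itv /= -ler_norml.
apply/cvg_ex; exists p => V nV.
have [//|FnV] := in_ultra_setVsetC (u @^-1` V) FU.
by have [x []] := clp (~` V) V FnV nV.
Qed.

(** * A discretised layer-cake formula *)

Section staircase.
Context {R : realType}.
Implicit Types (delta y : R).

(** For [0 <= y] this is [delta] times the minimum of [N] and the integer part of [y / delta].
    Written as a sum of indicators, it turns the integral of [f] into a combination of masses of
    superlevel sets, with error at most [delta] when [0 <= f <= N delta]; for continuous [f] these
    sets are closed. *)
Definition staircase delta N y := \sum_(k < N) delta * (k.+1%:R * delta <= y)%R%:R.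

Lemma staircaseS delta N y :
  staircase delta N.+1 y = staircase delta N y + delta * (N.+1%:R * delta <= y)%R%:R.
Proof. by rewrite /staircase big_ord_recr. Qed.

Lemma staircase_le delta N y : 0 < delta -> 0 <= y -> staircase delta N y <= y.
Proof.
move=> d0 y0.
have SN n : staircase delta n y <= n%:R * delta.
  elim: n => [|n IH]; first by rewrite /staircase big_ord0 mul0r.
  rewrite staircaseS -natr1 mulrDl mul1r; apply: lerD => //.
  by rewrite ler_piMr ?lern1 ?leq_b1// ltW.
elim: N => [|N IH]; first by rewrite /staircase big_ord0.
have [Ny|Ny] := leP (N.+1%:R * delta) y; first exact: le_trans (SN _) Ny.
by rewrite staircaseS (lt_geF Ny) mulr0 addr0.
Qed.

Lemma staircase_ge delta N y : 0 < delta -> y <= N%:R * delta ->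
  y <= delta + staircase delta N y.
Proof.
move=> d0; elim: N => [|N IH] yN.
  by rewrite /staircase big_ord0 addr0 (le_trans yN)// mul0r ltW.
rewrite staircaseS; have dN : 0 <= delta * (N.+1%:R * delta <= y)%R%:R.
  by rewrite mulr_ge0// ltW.
have [/IH yS|Ny] := leP y (N%:R * delta); first by rewrite addrA ler_wpDr.
suff -> : staircase delta N y = N%:R * delta.
  rewrite addrA ler_wpDr// (le_trans yN)//.
  by rewrite mulrS mulrDl mul1r.
rewrite /staircase (eq_bigr (fun=> delta)); first by rewrite sumr_const card_ord mulr_natl.
move=> k _; rewrite (_ : _ <= y) ?mulr1//.
rewrite (le_trans _ (ltW Ny))// ler_pM2r// ler_nat.
exact: ltn_ord.
Qed.

Context d (T : measurableType d) (P : probability T R).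
Variable f : T -> R.
Hypothesis bf : bounded_measurable f.

Let measurable_ge a : measurable [set x | a <= f x].
Proof.
rewrite (_ : [set _ | _] = f @^-1` `[a, +oo[); last first.
  by apply/seteqP; split => x /=; rewrite in_itv /= andbT.
by rewrite -[X in measurable X]setTI; exact: bf.1.
Qed.

Lemma bounded_measurable_staircase delta N :
  bounded_measurable (staircase delta N \o f).
Proof.
elim: N => [|N IH].
  rewrite (_ : _ \o _ = cst 0); first exact: bounded_measurable_cst.
  by apply/funext => x; rewrite /= /staircase big_ord0.
rewrite (_ : _ \o _ = fun x => (staircase delta N \o f) x +
    delta * (\1_[set x | N.+1%:R * delta <= f x] x)); last first.
  by apply/funext => x; rewrite /= staircaseS indicE mem_setE.
apply: bounded_measurableD => //; apply: bounded_measurableZ; split.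
  exact: measurable_indic.
by exists 1 => x; rewrite indicE; case: (_ \in _); rewrite ?normr1 ?normr0.
Qed.

Lemma expect_staircase delta N : \int[P]_x staircase delta N (f x) =
  \sum_(k < N) delta * fine (P [set x | k.+1%:R * delta <= f x]).
Proof.
elim: N => [|N IH].
  rewrite big_ord0; under eq_Rintegral do rewrite /staircase big_ord0.
  exact: expect_cst.
rewrite big_ord_recr /= -IH.
have mI := measurable_ge (N.+1%:R * delta).
have bI : bounded_measurable (\1_[set x | N.+1%:R * delta <= f x] : T -> R).
  split; first exact: measurable_indic.
  by exists 1 => x; rewrite indicE; case: (_ \in _); rewrite ?normr1 ?normr0.
have -> : fine (P [set x | N.+1%:R * delta <= f x]) =
    \int[P]_x \1_[set x | N.+1%:R * delta <= f x] x.
  by rewrite /Rintegral integral_indic// setIT.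
rewrite -expectZ// -expectD; last exact: bounded_measurableZ.
  by apply: eq_Rintegral => x _; rewrite staircaseS indicE mem_setE.
exact: bounded_measurable_staircase.
Qed.

Lemma expect_staircase_le delta N : 0 < delta -> (forall x, 0 <= f x) ->
  \sum_(k < N) delta * fine (P [set x | k.+1%:R * delta <= f x]) <= \int[P]_x f x.
Proof.
move=> d0 f0; rewrite -expect_staircase; apply: le_expect => //.
  exact: bounded_measurable_staircase.
by move=> x; exact: staircase_le.
Qed.

Lemma expect_staircase_ge delta N : 0 < delta -> (forall x, f x <= N%:R * delta) ->
  \int[P]_x f x <=
  delta + \sum_(k < N) delta * fine (P [set x | k.+1%:R * delta <= f x]).
Proof.
move=> d0 fN; rewrite -expect_staircase -[X in X + _](expect_cst P).
have b := bounded_measurable_cst T delta.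
have bs := bounded_measurable_staircase delta N.
rewrite -expectD//; apply: le_expect => //; first exact: bounded_measurableD.
by move=> x; exact: staircase_ge.
Qed.

End staircase.

(** * Construction of the weak limit *)

Section weak_limit.
Context {R : realType} {X : ptopologicalType}.
Hypotheses (cptX : compact [set: X]) (hausX : hausdorff_space X).
Variables (U : set_system nat) (mu : nat -> probability (borel X) R).
Hypothesis UU : UltraFilter U.

Let p n (C : set (borel X)) : R := fine (mu n C).

Let pE n C : measurable C -> (p n C)%:E = mu n C.
Proof. by move=> mC; rewrite fineK// fin_num_measure. Qed.

Let p_ge0 n C : 0 <= p n C. Proof. exact: fine_ge0. Qed.

Let p_le n C D : measurable C -> measurable D -> C `<=` D -> p n C <= p n D.
Proof.
by move=> mC mD CD; rewrite -lee_fin !pE//; apply: le_measure => //; exact: mem_set.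
Qed.

Let p_le1 n C : measurable C -> p n C <= 1.
Proof. by move=> mC; rewrite -lee_fin pE// probability_le1. Qed.

Let v (C : set X) : R := lim (p n C @[n --> U]).

Let cvg_v C : @closed X C -> p n C @[n --> U] --> v C.
Proof.
move=> cC; apply: (ultra_cvg_bounded (M := 1)) => // n.
by rewrite ger0_norm// p_le1//; exact: closed_borel.
Qed.

Let PU : ProperFilter U. Proof. exact: ultra_proper. Qed.

Lemma exists_weak_limit : exists m : probability (borel X) R, radon m /\
  forall f : X -> R, continuous f ->
    \int[mu n]_x f x @[n --> U] --> \int[m]_x f x.
Proof.
have v0 : v set0 = 0.
  apply: cvg_lim => //; rewrite (_ : p^~ set0 = cst 0); first exact: cvg_cst.
  by apply/funext => n; rewrite /p measure0.
have v_mono C D : closed C -> closed D -> C `<=` D -> v C <= v D.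
  move=> cC cD CD; apply: (ler_cvg_to (cvg_v cC) (cvg_v cD)).
  by apply: filterE => n; apply: p_le => //; exact: closed_borel.
have v_subU C D : closed C -> closed D -> v (C `|` D) <= v C + v D.
  move=> cC cD; apply: (ler_cvg_to (cvg_v (closedU cC cD)) (cvgD (cvg_v cC) (cvg_v cD))).
  apply: filterE => n; rewrite -lee_fin EFinD !pE; [|exact: closed_borel..|].
    by apply: measureU2; exact: closed_borel.
  by apply: closed_borel; exact: closedU.
have v_addU C D : closed C -> closed D -> C `&` D = set0 ->
    v (C `|` D) = v C + v D.
  move=> cC cD CD; apply: cvg_lim => //.
  rewrite (_ : (p^~ (C `|` D)) = (fun n => p n C + p n D)).
    exact: (cvgD (cvg_v cC) (cvg_v cD)).
  apply/funext => n; apply: EFin_inj; rewrite EFinD !pE; [|exact: closed_borel..|].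
    by apply: measureU => //; exact: closed_borel.
  by apply: closed_borel; exact: closedU.
have [m0 [rm0 m0T m0C]] :=
  content_radon_measure cptX hausX v0 v_mono v_subU v_addU.
have vT : v setT = 1.
  apply: cvg_lim => //; rewrite (_ : p^~ setT = cst 1); first exact: cvg_cst.
  by apply/funext => n; rewrite /p; have /= -> := probability_setT (mu n).
have [m mE] := probability_of_measure (etrans m0T (f_equal EFin vT)).
have {}mE : m = m0 :> (set (borel X) -> \bar R) by exact/funext.
exists m; split; first by rewrite /radon mE.
pose L f := lim (\int[mu n]_x f x @[n --> U]).
have cvgL (f : X -> R) : continuous f -> \int[mu n]_x f x @[n --> U] --> L f.
  move=> /(continuous_bounded_measurable cptX) bf; have [M fM] := bf.2.
  by apply: (ultra_cvg_bounded (M := M)) => // n; exact: expect_bounded.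
(* On closed sets [m] dominates the limit of [mu n]: hence the closed
   superlevel sets in the staircase, and the reverse inequality through [- f]. *)
have Lle0 (f : X -> R) : continuous f -> (forall x, 0 <= f x) ->
    L f <= \int[m]_x f x.
  move=> cf f0; have bf := continuous_bounded_measurable cptX cf.
  have [M fM] := bf.2.
  apply/ler_addgt0Pr => delta d0.
  have M0 : 0 <= M by exact: le_trans (normr_ge0 _) (fM point).
  have [N MN] : exists N : nat, M <= N%:R * delta.
    exists (Num.truncn (M / delta)).+1; rewrite -ler_pdivrMr// ltW//.
    by rewrite truncnS_gt.
  have fN x : f x <= N%:R * delta.
    by rewrite (le_trans _ MN)// (le_trans (ler_norm _)).
  pose F k := [set x : X | k.+1%:R * delta <= f x].
  have cF k : closed (F k).
    exact: ((continuous_closedP f).1 cf _ (@closed_ge R _)).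
  have cvgS : (\sum_(k < N) delta * p n (F k)) @[n --> U] -->
      \sum_(k < N) delta * v (F k).
    apply: cvg_big => [|k _]; first exact: add_continuous.
    by apply: cvgM; [exact: cvg_cst|exact: cvg_v].
  have cvgS' : (delta + \sum_(k < N) delta * p n (F k)) @[n --> U] -->
      delta + \sum_(k < N) delta * v (F k).
    by apply: cvgD => //; exact: cvg_cst.
  apply: (@le_trans _ _ (delta + \sum_(k < N) delta * v (F k))).
    apply: (ler_cvg_to (cvgL _ cf) cvgS'); apply: filterE => n.
    exact: (expect_staircase_ge (mu n) bf d0 fN).
  rewrite addrC lerD2r; apply: le_trans (expect_staircase_le m bf N d0 f0).
  apply: ler_sum => k _; rewrite ler_pM2l// -lee_fin fineK; last first.
    by rewrite fin_num_measure//; apply: closed_borel; exact: cF.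
  rewrite mE.
  by have := m0C _ (cF k); rewrite /F.
have Lle (f : X -> R) : continuous f -> L f <= \int[m]_x f x.
  move=> cf; have bf := continuous_bounded_measurable cptX cf.
  have [M fM] := bf.2.
  have bM := bounded_measurable_cst (borel X) M.
  (* [M] bounds the absolute value of [f], so the shifted function is nonnegative, and both sides
     change by [M]. *)
  pose g x := f x + M.
  have cg : continuous g by move=> x; apply: cvgD; [exact: cf|exact: cvg_cst].
  have := Lle0 g cg.
  rewrite (_ : L g = L f + M); last first.
    apply: cvg_lim => //; rewrite (_ : (fun n => _) = fun n => \int[mu n]_x f x + M).
      by apply: cvgD; [exact: cvgL|exact: cvg_cst].
    by apply/funext => n; rewrite expectD// expect_cst.
  rewrite expectD// expect_cst lerD2r; apply => x.
  by have := fM x; rewrite ler_norml /g => /andP[]; lra.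
move=> f cf; suff <- : L f = \int[m]_x f x by exact: cvgL.
apply/eqP; rewrite eq_le Lle//=.
have bf := continuous_bounded_measurable cptX cf.
pose g x := (-1) * f x.
have cg : continuous g by move=> x; apply: cvgM; [exact: cvg_cst|exact: cf].
have := Lle g cg; rewrite expectZ// (_ : L g = (-1) * L f); first by lra.
apply: cvg_lim => //; rewrite (_ : (fun n => _) = fun n => (-1) * \int[mu n]_x f x).
  by apply: cvgM; [exact: cvg_cst|exact: cvgL].
by apply/funext => n; rewrite expectZ.
Qed.

End weak_limit.

(** * Minimal energy *)

Section radon.
Context {R : realType} {X : ptopologicalType}.
Hypotheses (cptX : compact [set: X]) (hausX : hausdorff_space X).
Implicit Types nu : probability (borel X) R.

Lemma compact_borel (C : set (borel X)) : @compact X C -> measurable C.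
Proof. by move=> cC; apply: closed_borel; exact: compact_closed. Qed.

Lemma inner_regular_radon nu :
  (forall (A : set (borel X)) (e : R), measurable A -> 0 < e ->
     exists C : set X, [/\ compact C, C `<=` A & (nu A <= nu C + e%:E)%E]) ->
  radon nu.
Proof.
move=> reg; split => [C cC|A mA].
  by rewrite (le_lt_trans (probability_le1 nu (compact_borel cC)))// ltry.
apply/eqP; rewrite eq_le; apply/andP; split; last first.
  apply: ge_ereal_sup => _ [C [cC CA] <-].
  by apply: le_measure => //; apply: mem_set => //; exact: (compact_borel cC).
apply/lee_addgt0Pr => e e0; have [C [cC CA AC]] := reg A e mA e0.
apply: le_trans AC _; rewrite leeD2r//.
by have /ereal_sup_ubound := imageP nu (conj cC CA : [set C | compact C /\ C `<=` A] C).
Qed.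

Lemma radon_inner_regular nu (A : set (borel X)) (e : R) : radon nu ->
  measurable A -> 0 < e ->
  exists C : set X, [/\ compact C, C `<=` A & (nu A <= nu C + e%:E)%E].
Proof.
move=> [_ reg] mA e0; have fA : nu A \is a fin_num by rewrite fin_num_measure.
have := fA; rewrite (reg _ mA) => /(ub_ereal_sup_adherent e0)[_ [C [cC CA] <-]].
rewrite -(reg _ mA) lteBlDr// => /ltW AC.
by exists C.
Qed.

Lemma radon_dirac (a : X) : radon (dirac (a : borel X) : probability (borel X) R).
Proof.
apply: inner_regular_radon => A e mA e0.
have dE (B : set (borel X)) : (dirac (a : borel X) : probability (borel X) R) B =
  ((a \in B)%:R)%:E := diracE _ (a : borel X) B.
have [aA|aA] := boolP (a \in A).
  exists [set a]; split; first exact: compact_set1.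
    by move=> _ ->; exact: set_mem.
  by rewrite !dE aA mem_set//= leeDl// lee_fin ltW.
exists set0; split; [exact: compact0|exact: sub0set|].
by rewrite !dE (negbTE aA) in_set0 add0e lee_fin ltW.
Qed.

(** A bound [M] on the density turns a compact approximation of [A] for [nu] into one for [Q], the
    missing mass growing at most by the factor [M]. *)
Lemma radon_density nu (f : borel X -> R) : radon nu ->
  bounded_measurable f -> (forall x, 0 <= f x) -> \int[nu]_x f x = 1 ->
  exists Q : probability (borel X) R, radon Q /\
    forall h, bounded_measurable h -> \int[Q]_x h x = \int[nu]_x (h x * f x).
Proof.
move=> rnu bf f0 If; have [Q [QE Qh]] := exists_density bf f0 If.
exists Q; split => //; apply: inner_regular_radon => A e mA e0.
have [M fM] := bf.2.
have M0 : 0 <= M by exact: le_trans (normr_ge0 _) (fM point).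
(* [M + 1] rather than [M] makes the denominator visibly positive. *)
have eM : 0 < e / (M + 1) by rewrite divr_gt0// ltr_wpDl.
have [C [cC CA AC]] := radon_inner_regular rnu mA eM.
exists C; split => //.
have mC := compact_borel cC; have mD := measurableD mA mC.
have splitA (m : probability (borel X) R) : m A = (m C + m (A `\` C))%E.
  rewrite -measureU//; first by rewrite setDUK.
  by apply/seteqP; split => // x [? []].
rewrite splitA leeD2l//.
have nD : (nu (A `\` C) <= (e / (M + 1))%:E)%E.
  by move: AC; rewrite splitA leeD2lE// fin_num_measure.
rewrite QE//; apply: (@le_trans _ _ (\int[nu]_(x in A `\` C) (M%:E))%E).
  apply: ge0_le_integral => //.
  - by move=> x _; rewrite lee_fin.
  - by apply: measurable_funTS; apply/measurable_EFinP; exact: bf.1.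
  - by move=> x _; rewrite lee_fin (le_trans (ler_norm _)).
rewrite integral_cst//; apply: (@le_trans _ _ (M%:E * (e / (M + 1))%:E)%E).
  by rewrite lee_wpmul2l.
rewrite -EFinM lee_fin mulrCA ler_piMr ?(ltW e0)//.
by rewrite ler_pdivrMr ?ltr_wpDl// mul1r lerDl.
Qed.

End radon.

(** * Weak continuity and minimisation of the energy *)

Section minimal_energy.
Context {R : realType} {X : ptopologicalType}.
Hypotheses (cptX : compact [set: X]) (hausX : hausdorff_space X).
Variable K : X -> X -> R.
Hypothesis cK : continuous (fun z : X * X => K z.1 z.2).
Implicit Types nu : probability (borel X) R.

Let bK : bounded_measurable (fun z : borel X * borel X => K z.1 z.2).
Proof. exact: continuous_bounded_measurable2. Qed.

Let bKx x : bounded_measurable (K x : borel X -> R).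
Proof. exact: (@bounded_measurable_section _ (borel X) _ K x bK). Qed.

Lemma typicality_dist_le nu x x' (e : R) :
  (forall y, `|K x y - K x' y| < e) ->
  `|typicality K nu x - typicality K nu x'| <= e.
Proof.
move=> Ke; rewrite /typicality -expectB//; apply: expect_bounded.
  exact: bounded_measurableB.
by move=> y; exact: ltW.
Qed.

Lemma continuous_typicality nu : continuous (typicality K nu).
Proof.
move=> x; apply/cvgrPdist_le => e e0.
apply: (filterS _ (kernel_equicontinuous cptX x cK e0)) => x' Kxx'.
exact: typicality_dist_le.
Qed.

Lemma bounded_measurable_typicality nu :
  bounded_measurable (typicality K nu : borel X -> R).
Proof. exact: (continuous_bounded_measurable cptX (@continuous_typicality nu)). Qed.

Lemma continuous_kernel_section x : continuous (K x).
Proof.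
move=> y; have xy : (x, z) @[z --> y] --> (x, y).
  by apply: cvg_pair; [exact: cvg_cst|exact: cvg_id].
by have := cvg_comp _ _ xy (@cK (x, y)).
Qed.

Definition energy nu := \int[nu]_x typicality K nu x.

Section weak_continuity.
Variables (U : set_system nat) (mu : nat -> probability (borel X) R).
Variable m : probability (borel X) R.
Hypothesis UU : UltraFilter U.
Hypothesis weak : forall f : X -> R, continuous f ->
  \int[mu n]_x f x @[n --> U] --> \int[m]_x f x.

Let PU : ProperFilter U. Proof. exact: ultra_proper. Qed.

(** An Arzela-Ascoli argument: weak convergence gives pointwise convergence, equicontinuity
    inherited from [K] spreads it to a neighbourhood, and compactness makes it uniform. Uniformity
    is needed because the energy integrates against the varying measure. *)
Lemma typicality_uniform_cvg e : 0 < e -> \forall n \near U, forall x,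
  `|typicality K (mu n) x - typicality K m x| <= e.
Proof.
move=> e0; have e30 : 0 < e / 3 by rewrite divr_gt0.
have /compact_near_coveringP ncX := cptX.
suff cov : forall x : X, setT x -> \forall x' \near x & n \near U,
    `|typicality K (mu n) x' - typicality K m x'| <= e.
  have h := ncX nat U
    (fun n x => `|typicality K (mu n) x - typicality K m x| <= e) PU cov.
  by apply: filterS h => n hn x; exact: hn.
move=> x _.
have /cvgrPdist_le/(_ _ e30) hn := weak (@continuous_kernel_section x).
have hx := kernel_equicontinuous cptX x cK e30.
exists ([set x' | forall y, `|K x y - K x' y| < e / 3],
  [set n | `|typicality K m x - typicality K (mu n) x| <= e / 3]) => //=.
move=> [x' n] /= [Kx' Kn].
have := typicality_dist_le (mu n) Kx'; have := typicality_dist_le m Kx'.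
move: Kn; rewrite !ler_norml => /andP[? ?] /andP[? ?] /andP[? ?].
by apply/andP; split; lra.
Qed.

(** The difference splits into the integral of [K (mu n) - K m] against [mu n], small by uniform
    convergence, and the difference of the integrals of the fixed continuous function [K m], small
    by weak convergence. *)
Lemma energy_weak_cvg : energy (mu n) @[n --> U] --> energy m.
Proof.
apply/cvgrPdist_le => e e0; have e20 : 0 < e / 2 by rewrite divr_gt0.
have /cvgrPdist_le/(_ _ e20) h1 := weak (@continuous_typicality m).
have h2 := typicality_uniform_cvg e20.
apply: filterS2 h1 h2 => n hn1 hn2; rewrite /energy.
have bm := bounded_measurable_typicality m.
have bn := bounded_measurable_typicality (mu n).
have := expect_bounded (mu n) (bounded_measurableB bn bm) hn2.
rewrite expectB//; move: hn1; rewrite !ler_norml => /andP[? ?] /andP[? ?].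
by apply/andP; split; lra.
Qed.

End weak_continuity.

Hypothesis K0 : forall x y, 0 <= K x y.

Lemma energy_ge0 nu : 0 <= energy nu.
Proof. by apply: Rintegral_ge0 => x _; exact: Rintegral_ge0. Qed.

Lemma exists_energy_minimizer : exists mu : probability (borel X) R,
  radon mu /\ forall nu, radon nu -> energy mu <= energy nu.
Proof.
pose E := [set energy nu | nu in radon_probability R X].
have E0 : E !=set0.
  by exists (energy (dirac (point : borel X))), (dirac (point : borel X)) => //;
    exact: radon_dirac.
have hE : has_inf E.
  by split => //; exists 0 => _ [nu _ <-]; exact: energy_ge0.
have /choice[mu muP] (n : nat) : exists nu, radon nu /\ energy nu < inf E + n.+1%:R^-1.
  have n0 : 0 < n.+1%:R^-1 :> R by rewrite invr_gt0.
  by have [_ [nu rnu <-] nuE] := inf_adherent n0 hE; exists nu.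
(* [U] contains all tails, so the eventual bounds on the energies pass to the limit. *)
have [U [UU oU]] := ultraFilterLemma (@eventually_filter).
have [m [rm weak]] := exists_weak_limit cptX hausX mu UU.
exists m; split => // nu rnu.
apply: (@le_trans _ _ (inf E)); last by apply: ge_inf; [exact: hE.2|exists nu].
have cvgE := energy_weak_cvg UU weak.
apply/ler_addgt0Pr => e e0; have PU : ProperFilter U := ultra_proper.
apply: (ler_cvg_to cvgE (cvg_cst (inf E + e))); apply: oU.
near=> n; apply: le_trans (ltW (muP n).2) _; rewrite lerD2l ltW//.
by near: n; exact: near_infty_natSinv_lt (PosNum e0).
Unshelve. all: by end_near. Qed.

(** Serves twice: with [nu = mu] for perturbations of the minimiser, and with an arbitrary [nu] for
    the tilted competitor. *)
Lemma energy_density nu (f : borel X -> R) (mu : probability (borel X) R) :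
  radon nu -> bounded_measurable f -> (forall x, 0 <= f x) ->
  \int[nu]_x f x = 1 ->
  (forall nu', radon nu' -> energy mu <= energy nu') ->
  energy mu <= energy_form nu K f f.
Proof.
move=> rnu bf f0 If muE; have [Q [rQ Qh]] := radon_density hausX rnu bf f0 If.
apply: le_trans (muE Q rQ) _; rewrite /energy Qh; last exact: bounded_measurable_typicality.
rewrite le_eqVlt; apply/orP; left; apply/eqP; apply: eq_Rintegral => x _.
by rewrite /typicality Qh.
Qed.

End minimal_energy.

(** * Jensen's inequality and diversities *)

Section jensen.
Context d (T : measurableType d) (R : realType) (P : probability T R).

(** Diversities integrate over the support; this replaces the integrand by a bounded measurable
    function on the whole space that agrees with it there. *)
Lemma Rintegral_full_set (D : set T) (f g : T -> R) : measurable D ->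
  P (~` D) = 0%E -> bounded_measurable g -> {in D, f =1 g} ->
  \int[P]_(x in D) f x = \int[P]_x g x.
Proof.
move=> mD PD bg fg; rewrite (eq_Rintegral P fg).
have mDC := measurableC mD.
have dD : [disjoint D & ~` D] by apply/disj_setPS; rewrite setICr.
have iD : P.-integrable (D `|` ~` D) (EFin \o g).
  by rewrite setUCr; exact: integrable_bounded_measurable.
rewrite -[in RHS](setUCr D) Rintegral_setU//.
rewrite [X in _ = _ + X](_ : _ = 0) ?addr0// /Rintegral null_set_integral//.
by apply: measurable_funTS; apply/measurable_EFinP; exact: bg.1.
Qed.

Variable y : T -> R.
Hypothesis bdd_y : bounded_measurable y.

Lemma bounded_measurable_expR p : bounded_measurable (fun x => expR (p * y x)).
Proof.
have [mp [M pM]] := bounded_measurableZ p bdd_y; split.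
  exact: (measurableT_comp (@measurable_expR R) mp).
exists (expR M) => x; rewrite ger0_norm ?expR_ge0// ler_expR.
exact: le_trans (ler_norm _) (pM x).
Qed.

Lemma expect_expR_gt0 p : 0 < \int[P]_x expR (p * y x).
Proof.
have [_ [M pM]] := bounded_measurableZ p bdd_y.
apply: (@lt_le_trans _ _ (expR (- M))); first exact: expR_gt0.
rewrite -[leLHS](expect_cst P); apply: le_expect.
- exact: bounded_measurable_cst.
- exact: bounded_measurable_expR.
by move=> x; rewrite ler_expR; have := pM x; rewrite ler_norml => /andP[].
Qed.

Let a := \int[P]_x expR (y x).
Let b := ln a.

Let bexp : bounded_measurable (fun x => expR (y x)).
Proof. by have := bounded_measurable_expR 1; under eq_fun do rewrite mul1r. Qed.

Let a_gt0 : 0 < a.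
Proof. by have := expect_expR_gt0 1; under eq_Rintegral do rewrite mul1r. Qed.

Let expRb : expR b = a. Proof. by rewrite lnK// posrE. Qed.

(** With [u = exp (y - b)], the integrand is the tangent at 1 of [u^p]; the choice [b = ln a] gives
    [u] mean 1. *)
Let tangent p : \int[P]_x (1 + p * (expR (- b) * expR (y x) - 1)) = 1.
Proof.
have b1 := bounded_measurable_cst T (1 : R).
have be := bounded_measurableZ (expR (- b)) bexp.
have bd := bounded_measurableB be b1.
rewrite expectD ?expectZ ?expectB ?expect_cst ?expectZ//; last first.
  exact: bounded_measurableZ.
by rewrite -/a -expRb -expRD addNr expR0 subrr mulr0 addr0.
Qed.

Let btangent p : bounded_measurable (fun x => 1 + p * (expR (- b) * expR (y x) - 1)).
Proof.
have b1 := bounded_measurable_cst T (1 : R).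
apply: bounded_measurableD => //; apply: bounded_measurableZ.
by apply: bounded_measurableB => //; exact: bounded_measurableZ.
Qed.

Let expect_expRE p : \int[P]_x (expR (- (p * b)) * expR (p * y x)) =
  expR (- (p * b)) * \int[P]_x expR (p * y x).
Proof. by rewrite expectZ//; exact: bounded_measurable_expR. Qed.

Lemma expect_le_ln_expR : \int[P]_x y x <= ln a.
Proof.
rewrite -/b -[leRHS]addr0 -subr_le0 opprD addrA.
have b1 := bounded_measurable_cst T (1 : R).
have : \int[P]_x (1 + (y x - b)) <= 1.
  rewrite -[leRHS](tangent 1); apply: le_expect => //.
    by apply: bounded_measurableD => //; apply: bounded_measurableB => //;
      exact: bounded_measurable_cst.
  move=> x; rewrite mul1r -expRD [- b + _]addrC.
  by have := expR_ge1Dx (y x - b); lra.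
rewrite expectD ?expectB ?expect_cst//.
- by lra.
- exact: bounded_measurable_cst.
- by apply: bounded_measurableB => //; exact: bounded_measurable_cst.
Qed.

(** Monotonicity of power means, at exponents [p] and 1. For [y = - ln (K nu)] and [p = 1 - q] the
    left side is the diversity of order [q], so [p <= 1] is exactly [q >= 0]. The power [u^p] is
    compared with its tangent at the mean 1 of [u]. *)
Lemma expect_expR_powR p : p != 0 -> p <= 1 ->
  (\int[P]_x expR (p * y x)) `^ p^-1 <= a.
Proof.
move=> p0 p1; set I := \int[P]_x _.
have I0 : 0 < I by exact: expect_expR_gt0.
rewrite /powR gt_eqF// -expRb ler_expR.
have bI : bounded_measurable (fun x => expR (- (p * b)) * expR (p * y x)).
  by apply: bounded_measurableZ; exact: bounded_measurable_expR.
have lnI : expR (- (p * b)) * I = expR (ln I - p * b).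
  by rewrite expRD lnK ?posrE// mulrC.
have [p_gt0|p_lt0|p_eq0] := ltgtP p 0; last by rewrite p_eq0 eqxx in p0.
(* Here [p < 0]: the power is convex and lies above its tangent, and the exponent [p^-1] reverses
   the inequality. *)
- suff : 1 <= expR (- (p * b)) * I.
    rewrite lnI -expR0 ler_expR subr_ge0 => h.
    by rewrite mulrC ler_ndivrMr// mulrC.
  rewrite -expect_expRE -(tangent p); apply: le_expect => // x.
  rewrite -!expRD -mulrN -mulrDr.
  set z := - b + y x; have := expR_ge1Dx (p * z); have := expR_ge1Dx z.
  by move=> h1; apply: le_trans; rewrite lerD2l ler_nM2l//; lra.
(* Here [0 < p <= 1]: the power is concave and lies below its tangent. *)
- suff : expR (- (p * b)) * I <= 1.
    rewrite lnI -[X in _ <= X]expR0 ler_expR subr_le0 => h.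
    by rewrite mulrC ler_pdivrMr// mulrC.
  rewrite -expect_expRE -[leRHS](tangent p); apply: le_expect => // x.
  rewrite -!expRD -mulrN -mulrDr.
  set z := - b + y x; set s := 1 + p * (expR z - 1).
  have ez := expR_gt0 z.
  have s0 : 0 < s.
    have : 0 < p * expR z by exact: mulr_gt0.
    by rewrite /s; lra.
  (* weighted AM-GM, from [exp u >= 1 + u] at [z - ln s] and at [- ln s] *)
  have := expR_ge1Dx (z - ln s); have := expR_ge1Dx (- ln s).
  rewrite expRD expRN lnK ?posrE// => h1 h2.
  rewrite -[leRHS](lnK (x := s)) ?posrE// ler_expR.
  have q1 : 0 <= 1 - p by lra.
  have := ler_wpM2l q1 h1; have := ler_wpM2l (ltW p_lt0) h2.
  have : p * (expR z / s) + (1 - p) * s^-1 = 1.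
    rewrite mulrA -mulrDl (_ : _ + _ = s) ?divff ?gt_eqF//.
    by rewrite /s; ring.
  by lra.
Qed.

End jensen.

(** * Supports of Radon probability measures *)

Section support.
Context {R : realType} {X : ptopologicalType}.
Hypotheses (cptX : compact [set: X]) (hausX : hausdorff_space X).
Variable nu : probability (borel X) R.
Hypothesis rnu : radon nu.

Lemma closed_supp : closed (supp nu).
Proof. by apply: closed_bigI => C []. Qed.

Lemma measurable_supp : measurable (supp nu : set (borel X)).
Proof. exact: closed_borel closed_supp. Qed.

Lemma supp_sub (C : set X) : closed C -> nu (~` C) = 0%E -> supp nu `<=` C.
Proof. by move=> cC nC x; apply. Qed.

Lemma measure_gt0_supp x (V : set X) : open V -> V x -> supp nu x -> (0 < nu V)%E.
Proof.
move=> oV Vx sx; rewrite lt0e measure_ge0 andbT; apply/eqP => nV.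
have /(_ x sx) : supp nu `<=` ~` V.
  by apply: supp_sub; [exact: open_closedC|rewrite setCK].
exact.
Qed.

(** The complement of the support is a possibly uncountable union of null open sets. Inner
    regularity reduces the claim to compact subsets, each covered by finitely many of them. *)
Lemma supp_full : nu (~` supp nu) = 0%E.
Proof.
have mS := measurableC measurable_supp.
rewrite (rnu.2 _ mS); apply/eqP; rewrite eq_le; apply/andP; split; last first.
  apply: ereal_sup_ubound; exists set0; last by rewrite measure0.
  by split; [exact: compact0|exact: sub0set].
apply: ge_ereal_sup => _ [C [cC CS] <-].
have /choice[W WP] (x : X) : exists W : set X, ~ supp nu x ->
    [/\ open W, W x & nu W = 0%E].
  have [sx|] := pselect (supp nu x); first by exists set0.
  move=> /existsNP[D /not_implyP[[cD nD] Dx]]; exists (~` D) => _.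
  by split => //; exact: closed_openC.
have [] : finite_subset_cover (~` supp nu) W C.
  have : cover_compact C by rewrite -(compact_cover X).
  apply=> [x /WP[]//|x /CS Sx]; exists x => //.
  by have [] := WP x Sx.
move=> D DS CD; have mC := compact_borel hausX cC.
suff -> : nu C = 0%E by [].
apply: measure_negligible => //; apply: (@negligibleS _ _ _ nu _ _ CD).
rewrite /cover bigcup_fset big_seq; apply: big_ind.
- exact: negligible_set0.
- by move=> A B; exact: negligibleU.
move=> x /DS/set_mem/WP[oW _ nW].
by apply/negligibleP => //; exact: open_borel.
Qed.

End support.

(** * Upper bounds and values of the diversities *)

Section diversity.
Context {R : realType} {X : ptopologicalType}.
Hypotheses (cptX : compact [set: X]) (hausX : hausdorff_space X).
Variable K : X -> X -> R.
Hypothesis simK : similarity_kernel K.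
Variable nu : probability (borel X) R.
Hypothesis rnu : radon nu.

Let k := typicality K nu.

Let cK : continuous (fun z : X * X => K z.1 z.2). Proof. by case: simK. Qed.

Let ck : continuous k. Proof. exact: continuous_typicality. Qed.

Let bk : bounded_measurable (k : borel X -> R).
Proof. exact: bounded_measurable_typicality. Qed.

Let mS : measurable (supp nu : set (borel X)).
Proof. exact: measurable_supp. Qed.

Let S0 : nu (~` supp nu) = 0%E.
Proof. exact: supp_full. Qed.

Lemma supp_neq0 : supp nu !=set0.
Proof.
apply/set0P/eqP => S_eq0; have := S0; rewrite S_eq0 setC0.
by have /= -> := probability_setT nu => /eqP; rewrite onee_eq0.
Qed.

(** [K x] exceeds [K x x / 2] on an open neighbourhood of [x], which has positive mass. *)
Lemma typicality_gt0 x : supp nu x -> 0 < k x.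
Proof.
move=> sx; have [_ K0 /(_ x) Kxx] := simK.
have K2 : 0 < K x x / 2 by rewrite divr_gt0.
pose V := [set y | K x x / 2 < K x y].
have oV : open V.
  by have /continuousP h := @continuous_kernel_section _ _ _ cK x;
    exact: (h _ (@open_gt R _)).
have Vx : V x by rewrite /V /=; lra.
have nV := measure_gt0_supp oV Vx sx.
have mV : measurable (V : set (borel X)) by exact: open_borel.
have bV : bounded_measurable (\1_V : borel X -> R).
  split; first exact: measurable_indic.
  by exists 1 => y; rewrite indicE; case: (_ \in _); rewrite ?normr1 ?normr0.
apply: (@lt_le_trans _ _ (\int[nu]_y (K x x / 2 * \1_V y))).
  rewrite expectZ// /Rintegral integral_indic// setIT mulr_gt0// fine_gt0// nV /=.
  exact: le_lt_trans (probability_le1 _ mV) (ltry _).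
apply: le_expect; first exact: bounded_measurableZ.
  apply: (continuous_bounded_measurable cptX).
  exact: (@continuous_kernel_section _ _ _ cK x).
move=> y; rewrite indicE; have [/set_mem Vy|_] := boolP (y \in V).
  by rewrite mulr1; exact: ltW.
by rewrite mulr0; exact: K0.
Qed.

Lemma typicality_lower_bound : exists2 m, 0 < m & forall x, supp nu x -> m <= k x.
Proof.
have /compact_near_coveringP ncS : compact (supp nu).
  exact: (closed_compactT cptX (@closed_supp _ _ nu)).
(* With [0^'+] as the second filter, local lower bounds hold for all small [m], and compactness
   yields one [m] for the whole support. *)
have cov : forall x : X, supp nu x ->
    \forall x' \near x & m \near (0 : R)^'+, m <= k x'.
  move=> x /typicality_gt0 kx; have kx2 : 0 < k x / 2 by rewrite divr_gt0.
  exists ([set x' | k x / 2 < k x'], [set m | m <= k x / 2]) => /=.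
    split; last exact: nbhs_right_le.
    apply: open_nbhs_nbhs; split => /=; last by lra.
    by have /continuousP h := ck; exact: (h _ (@open_gt R _)).
  by move=> [x' m] /= [kx' mk]; exact: le_trans mk (ltW kx').
have h := ncS R _ (fun m x => m <= k x) (at_right_proper_filter 0) cov.
have /filter_ex[m [m0 hm]] : \forall m \near (0 : R)^'+,
    0 < m /\ supp nu `<=` (fun x => m <= k x).
  exact: (filterI (nbhs_right_gt 0) h).
by exists m.
Qed.

(* [w] extends [1 / k] from the support, where [k] is bounded below. *)
Lemma diversity_le_expect : exists w : borel X -> R,
  [/\ bounded_measurable w, forall x, 0 < w x, forall x, k x * w x <= 1,
   0 < \int[nu]_x w x &
   forall q : \bar R, (0 <= q)%E -> diversity K q nu <= \int[nu]_x w x].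
Proof.
have [m m0 km] := typicality_lower_bound.
pose k' x := Num.max (k x) m; pose y x := - ln (k' x).
have mk' x : m <= k' x by rewrite le_max lexx orbT.
have k'0 x : 0 < k' x by exact: lt_le_trans (mk' x).
have k'E x : supp nu x -> k' x = k x by move=> /km mk; exact/max_idPl.
have [M kM] := bk.2.
have bY : bounded_measurable (y : borel X -> R).
  split.
    apply: measurable_funN; apply: (measurableT_comp (@measurable_ln R)).
    by apply: measurable_maxr => //; exact: bk.1.
  exists (`|ln m| + `|ln (Num.max M m)|) => x; rewrite normrN.
  have h1 : ln m <= ln (k' x) by rewrite ler_ln ?posrE.
  have h2 : ln (k' x) <= ln (Num.max M m).
    rewrite ler_ln ?posrE// ?lt_max ?m0 ?orbT//.
    by rewrite ge_max le_max (le_trans (ler_norm _) (kM x))//= le_max lexx orbT.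
  rewrite ler_norml; have := ler_norm (ln (Num.max M m)).
  have := ler_norm (- ln m); rewrite normrN.
  have := normr_ge0 (ln m); have := normr_ge0 (ln (Num.max M m)).
  by move=> *; apply/andP; split; lra.
pose w x := expR (y x).
have wE x : w x = (k' x)^-1 by rewrite /w /y expRN lnK// posrE.
have bw : bounded_measurable (w : borel X -> R).
  by have := bounded_measurable_expR bY 1; under eq_fun do rewrite mul1r.
have Iw : 0 < \int[nu]_x w x.
  by have := expect_expR_gt0 nu bY 1; under eq_Rintegral do rewrite mul1r.
exists w; split => //.
- by move=> x; exact: expR_gt0.
- by move=> x; rewrite wE ler_pdivrMr// mul1r le_max lexx.
case => [r r0|_|//] /=.
- case: ifPn => [_|r1].
    rewrite (Rintegral_full_set mS S0 (bounded_measurableZ (-1) bY)); last first.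
      by move=> x /set_mem sx; rewrite /y k'E// mulN1r opprK.
    rewrite expectZ// mulN1r opprK -[leRHS]lnK ?posrE// ler_expR.
    exact: expect_le_ln_expR.
  (* On the support [k^(r - 1)] is [exp ((1 - r) y)]. *)
  rewrite (Rintegral_full_set mS S0 (bounded_measurable_expR bY (1 - r))); last first.
    move=> x /set_mem sx; rewrite /y k'E// /powR gt_eqF ?typicality_gt0//.
    by congr expR; rewrite mulrN -mulNr opprB.
  apply: expect_expR_powR => //; first by rewrite subr_eq0 eq_sym.
  by rewrite lerBlDr lerDl -lee_fin.
(* Order infinity: on a set [D] of full measure [1 / s <= 1 / k = w], and integrating gives the
   bound. A point of [D] also shows [m <= s], so that [s] is positive and finite. *)
have esup := ess_sup_ge nu (EFin \o k).
set s := ess_sup _ _ in esup *.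
have sM : (s <= M%:E)%E.
  apply/ess_supP; apply: aeW => x /=; rewrite lee_fin.
  exact: le_trans (ler_norm _) (kM x).
have mD : measurable [set x : borel X | ((k x)%:E <= s)%E].
  have mk : measurable_fun setT (EFin \o k : borel X -> \bar R).
    by apply/measurable_EFinP; exact: bk.1.
  by rewrite -[X in measurable X]setTI; exact: emeasurable_fun_infty_c.
pose D := [set x : borel X | ((k x)%:E <= s)%E] `&` supp nu.
have mDS : measurable D by exact: measurableI.
have nD : nu (~` D) = 0%E.
  rewrite setCI; apply: measure_negligible.
    by apply: measurableU; exact: measurableC.
  apply: negligibleU => //; apply/negligibleP => //; exact: measurableC.
have [x [/= xs sx]] : D !=set0.
  apply/set0P/eqP => D0; move: nD; rewrite D0 setC0.
  by have /= -> := probability_setT nu => /eqP; rewrite onee_eq0.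
have ms : (m%:E <= s)%E by apply: le_trans xs; rewrite lee_fin km.
have sfin : s \is a fin_num.
  by rewrite fin_numElt (lt_le_trans _ ms) ?ltNyr// (le_lt_trans sM)// ltry.
have fs0 : 0 < fine s by apply: lt_le_trans m0 _; rewrite -lee_fin fineK.
rewrite -(@Rintegral_full_set _ _ _ nu D w w)//.
have bs := bounded_measurable_cst (borel X) (fine s)^-1.
rewrite -[leLHS](expect_cst nu) -(@Rintegral_full_set _ _ _ nu D (cst (fine s)^-1))//.
apply: le_Rintegral => //.
- exact: (integrable_bounded_measurable nu mDS bs).
- exact: (integrable_bounded_measurable nu mDS bw).
move=> z [/= zs sz]; rewrite wE lef_pV2 ?posrE// k'E//.
by rewrite -lee_fin (fineK sfin).
Qed.

(** By continuity [k = c] holds on a closed set of full measure, hence everywhere on the support,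
    where all the integrands become constant. *)
Lemma diversity_balanced c : {ae nu, forall x, k x = c} ->
  0 < c /\ forall q : \bar R, (0 <= q)%E -> diversity K q nu = c^-1.
Proof.
move=> kc.
have cC : closed [set x | k x = c].
  by have /continuous_closedP h := ck; exact: (h _ (@closed_eq R c)).
have Sc : supp nu `<=` [set x | k x = c].
  apply: supp_sub => //; apply: measure_negligible kc.
  by apply: measurableC; exact: closed_borel.
have c0 : 0 < c.
  by have [x sx] := supp_neq0; rewrite -(Sc x sx); exact: typicality_gt0.
have nS : fine (nu (supp nu)) = 1.
  have := expect_cst nu 1.
  rewrite -(@Rintegral_full_set _ _ _ nu (supp nu) (cst 1))//.
    by rewrite Rintegral_cst// mul1r.
  exact: bounded_measurable_cst.
split => //; case => [r r0|_|//] /=.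
- case: ifPn => [_|r1].
    rewrite (@eq_Rintegral _ _ _ nu (supp nu) (cst (ln c))); last first.
      by move=> x /set_mem/Sc /= <-.
    by rewrite Rintegral_cst// nS mulr1 expRN lnK// posrE.
  rewrite (@eq_Rintegral _ _ _ nu (supp nu) (cst (c `^ (r - 1)))); last first.
    by move=> x /set_mem/Sc /= <-.
  rewrite Rintegral_cst// nS mulr1 -powRrM -opprB mulNr divff ?subr_eq0 1?eq_sym//.
  by rewrite powR_inv1// ltW.
rewrite (ess_sup_ae_cst c%:E)//; first by have /= -> := probability_setT nu.
apply: (@filterS _ _ (ae_filter_ringOfSetsType nu) _ _ _ kc) => x kx.
by rewrite -[in RHS](kx : k x = c).
Qed.

End diversity.

(** * The energy minimiser maximises every diversity *)

Section maximum_diversity.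
Context {R : realType} {X : ptopologicalType}.
Variable K : X -> X -> R.
Hypotheses (cptX : compact [set: X]) (hausX : hausdorff_space X).
Hypotheses (simK : similarity_kernel K) (symK : symmetric_kernel K).

Lemma exists_balanced_maximizer :
  exists (mu : probability (borel X) R) (c : R), [/\ radon mu,
    forall q : \bar R, (0 <= q)%E -> diversity K q mu = c^-1 &
    forall nu : probability (borel X) R, radon nu ->
      forall q : \bar R, (0 <= q)%E -> diversity K q nu <= c^-1].
Proof.
have [cK K0 _] := simK.
have [mu [rmu muE]] := exists_energy_minimizer cptX hausX cK K0.
have bK := continuous_bounded_measurable2 cptX cK.
have typE (nu : probability (borel X) R) x :
    potential nu K (cst 1) x = typicality K nu x.
  by apply: eq_Rintegral => y _; rewrite mulr1.
have formE : energy_form mu K (cst 1) (cst 1) = energy K mu.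
  by apply: eq_Rintegral => x _; rewrite mulr1 typE.
have bal : {ae mu, forall x, typicality K mu x = energy K mu}.
  rewrite -formE; have h := energy_minimizer_balanced bK symK _.
  apply: filterS (h mu _) => [x|f bf f0 If]; first by rewrite typE.
  by rewrite formE; exact: (energy_density cptX hausX cK).
have [c0 muD] := diversity_balanced cptX hausX simK rmu bal.
exists mu, (energy K mu); split => // nu rnu q q0.
have [w [bw w0 kw Iw]] := diversity_le_expect cptX hausX simK rnu.
move=> /(_ q q0)/le_trans; apply; set D := \int[nu]_x w x in Iw *.
pose f x := D^-1 * w x.
have bf : bounded_measurable f by exact: bounded_measurableZ.
have f0 x : 0 <= f x by rewrite mulr_ge0 ?invr_ge0// ltW.
have If : \int[nu]_x f x = 1 by rewrite expectZ// mulVf// gt_eqF.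
have := energy_density cptX hausX cK rnu bf f0 If muE.
have -> : energy_form nu K f f = D^-1 * (D^-1 * energy_form nu K w w).
  transitivity (D^-1 * energy_form nu K f w); first exact: energy_formZr.
  by congr (_ * _); rewrite energy_formC//; exact: energy_formZr.
have := energy_form_le_sqr nu bK symK K0 bw.
(* From [k w <= 1]: the integrand is at most [w]. Hence the energy of [w nu] is at most [D], and
   that of the normalised measure at most [1 / D]. *)
have : \int[nu]_x (potential nu K (cst 1) x * (w x * w x)) <= D.
  apply: le_expect => //.
    apply: bounded_measurableM; last exact: bounded_measurableM.
    exact: bounded_measurable_potential (bounded_measurable_cst _ _).
  by move=> x; rewrite typE mulrA ler_piMl// ltW.
move=> h1 h2 h3; have {h1 h2} ED := le_trans h2 h1.
rewrite -[D]invrK lef_pV2 ?posrE ?invr_gt0//; apply: le_trans h3 _.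
rewrite ler_piMr ?invr_ge0 ?(ltW Iw)//.
by rewrite mulrC ler_pdivrMr// mul1r.
Qed.

End maximum_diversity.

Theorem theorem7p1 (R : realType) (X : ptopologicalType) (K : X -> X -> R)
  (cptX : compact [set: X]) (hausX : hausdorff_space X)
  (simK : similarity_kernel K) (symK : symmetric_kernel K) :
  (exists mu : probability (borel X) R, radon_probability R X mu /\
     forall nu : probability (borel X) R, radon_probability R X nu ->
     forall q : \bar R, (0 <= q)%E -> diversity K q nu <= diversity K q mu) /\
  (forall q q' : \bar R, (0 <= q)%E -> (0 <= q')%E ->
     ereal_sup [set (diversity K q nu)%:E | nu in radon_probability R X] =
     ereal_sup [set (diversity K q' nu)%:E | nu in radon_probability R X]).
Proof.
have [mu [c [rmu muD leD]]] := exists_balanced_maximizer cptX hausX simK symK.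
split; first by exists mu; split => // nu rnu q q0; rewrite muD//; exact: leD.
have supE q : (0 <= q)%E -> ereal_sup
    [set (diversity K q nu)%:E | nu in radon_probability R X] = (c^-1)%:E.
  move=> q0; apply/eqP; rewrite eq_le; apply/andP; split.
    by apply: ge_ereal_sup => _ [nu rnu <-]; rewrite lee_fin; exact: leD.
  by apply: ereal_sup_ubound; exists mu => //; rewrite muD.
by move=> q q' q0 q'0; rewrite !supE.
Qed.
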